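(* There is an algorithm which, given a finite set $V$ of $n$ vertices, an integer $\ell\ge 0$ and an $\ell$-bounded weight function $w:V^2\to\mathbb{N}$, solves the Channel Assignment problem for $w$ (i.e.\ finds the minimum span of $w$ and a proper assignment attaining it) in time $O(2^n(\ell+1)^{n/2}n^2)$.
   Context: $\mathbb{N}=\{0,1,2,\dots\}$. In the Channel Assignment problem one is given a finite set $V$ (of vertices) and a symmetric weight function $w:V^2\to\mathbb{N}$. The function $w$ is $\ell$-bounded if $w(x,y)\le \ell$ for all $x,y\in V$. An assignment $c:V\to\{1,\dots,s\}$ is proper if $|c(x)-c(y)|\ge w(x,y)$ for every pair of distinct vertices $x,y\in V$; the number $s$ is called the span of $c$. The goal is to find a proper assignment of minimum span; this minimum is the span of $w$. *)

(* Defs.v *)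
From mathcomp Require Import all_boot all_order all_algebra.

Set Implicit Arguments.
Unset Strict Implicit.
Unset Printing Implicit Defensive.

Section ChannelAssignment.
Variables (V : finType) (w : V -> V -> nat).

Definition weight_function := forall x y, w x y = w y x.

Definition bounded (l : nat) := forall x y, w x y <= l.

(* The range condition says c : V -> {1, ..., s}; [`|m - n|] is the distance,
   not truncated subtraction. *)
Definition proper_assignment (s : nat) (c : V -> nat) :=
  (forall x, 1 <= c x <= s) /\
  (forall x y, x != y -> w x y <= `|c x - c y|%N).

Definition optimal_assignment (s : nat) (c : V -> nat) :=
  proper_assignment s c /\
  forall s' c', proper_assignment s' c' -> s <= s'.

End ChannelAssignment.

(* Word RAM with words of [b] bits.  A program names finitely many registers and
   reaches the memory, whose cells are indexed by words, through registers. *)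

Inductive binop := OAdd | OSub | OMul | ODiv | OMod | OLt | OEq.

(* Arithmetic modulo 2^b; in particular OSub wraps around.  ODiv and OMod follow
   the conventions m %/ 0 = 0 and m %% 0 = m. *)
Definition eval_op (b : nat) (o : binop) (x y : nat) : nat :=
  match o with
  | OAdd => (x + y) %% 2 ^ b
  | OSub => (x + (2 ^ b - y)) %% 2 ^ b
  | OMul => (x * y) %% 2 ^ b
  | ODiv => (x %/ y) %% 2 ^ b
  | OMod => (x %% y) %% 2 ^ b
  | OLt => (x < y) %% 2 ^ b
  | OEq => (x == y) %% 2 ^ b
  end.

Definition reg := nat.

Inductive prog :=
  | Skip
  | Const of reg & nat               (* Const r k       :  r := k *)
  | Op of reg & binop & reg & reg    (* Op r o r1 r2    :  r := r1 o r2 *)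
  | Read of reg & reg                (* Read r a        :  r := M[a] *)
  | Write of reg & reg               (* Write a r       :  M[a] := r *)
  | Seq of prog & prog
  | If of reg & prog & prog          (* a register is true if nonzero *)
  | While of reg & prog.

Record state := State { regs : reg -> nat; mem : nat -> nat }.

Definition upd (f : nat -> nat) (i v : nat) : nat -> nat :=
  fun j => if j == i then v else f j.

Definition set_reg (st : state) (r v : nat) : state :=
  State (upd (regs st) r v) (mem st).

Definition set_mem (st : state) (a v : nat) : state :=
  State (regs st) (upd (mem st) a v).

(* [exec b p st t st']: started in [st] on the b-bit machine, [p] halts in [st']
   after [t] steps; each instruction and each branch or loop test is one step. *)
Inductive exec (b : nat) : prog -> state -> nat -> state -> Prop :=
  | exec_skip st : exec b Skip st 1 st
  | exec_const r k st :
      exec b (Const r k) st 1 (set_reg st r (k %% 2 ^ b))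
  | exec_op r o r1 r2 st :
      exec b (Op r o r1 r2) st 1
        (set_reg st r (eval_op b o (regs st r1) (regs st r2)))
  | exec_read r a st :
      exec b (Read r a) st 1 (set_reg st r (mem st (regs st a)))
  | exec_write a r st :
      exec b (Write a r) st 1 (set_mem st (regs st a) (regs st r))
  | exec_seq p q st1 st2 st3 t1 t2 :
      exec b p st1 t1 st2 -> exec b q st2 t2 st3 ->
      exec b (Seq p q) st1 (t1 + t2) st3
  | exec_if_true r p q st st' t :
      regs st r != 0 -> exec b p st t st' -> exec b (If r p q) st t.+1 st'
  | exec_if_false r p q st st' t :
      regs st r = 0 -> exec b q st t st' -> exec b (If r p q) st t.+1 st'
  | exec_while_true r p st1 st2 st3 t1 t2 :
      regs st1 r != 0 -> exec b p st1 t1 st2 ->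
      exec b (While r p) st2 t2 st3 ->
      exec b (While r p) st1 (t1 + t2).+1 st3
  | exec_while_false r p st :
      regs st r = 0 -> exec b (While r p) st 1 st.

(* n = #|V| in register 0, l in register 1, the n x n weight matrix row by row in
   cells 0, ..., n^2 - 1, vertices in the order of [enum V]; 0 elsewhere. *)
Definition input (V : finType) (w : V -> V -> nat) (l : nat) : state :=
  State
    (fun r => if r == 0 then #|V| else if r == 1 then l else 0)
    (fun a =>
       nth 0 [seq w x y | x <- enum V, y <- enum V] a).

(* The span is left in register 0, the colour of the i-th vertex in cell i. *)
Definition output_span (st : state) : nat := regs st 0.

Definition output_assignment (V : finType) (st : state) (x : V) : nat :=
  mem st (enum_rank x).

(* Main.v *)
Require Import Defs.
From mathcomp Require Import all_boot all_order all_algebra.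
From mathcomp Require Import reals exp.
From mathcomp Require Import zify.

(* Colour the vertices one by one in a fixed order, giving each the least colour
   that is at least the previous one and compatible with its predecessors.  For
   the order induced by an optimal assignment this greedy colouring is optimal,
   so the span is a shortest path length in the graph of partial greedy
   colourings.  What a partial colouring with current span s does to the
   remaining vertices is captured by the lower bounds s, ..., s + l that it puts
   on each of them, and two partial colourings of the same set with the same
   relative lower bounds are merged into one state.

   Meet in the middle occurs in the counting of the states: if more than n/2
   vertices are coloured, there are at most (l+1)^(n/2) vectors of lower bounds;
   if at most n/2 are, the lower bounds are a function of the distances of the
   coloured vertices to s, truncated at l, so that again (l+1)^(n/2) vectors are
   possible.  A breadth-first search expands at most 2^n (l+1)^(n/2) states in
   O(n^2) steps each. *)

Set Implicit Arguments.
Unset Strict Implicit.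
Unset Printing Implicit Defensive.

(** * Partial greedy colourings and their codes in base [l + 2] *)

Section Codes.
Variables (n l : nat) (W : nat -> nat -> nat).
Hypothesis W_le : forall x y, W x y <= l.
Local Notation B := l.+2.

Definition mk k (f : nat -> nat) := \sum_(i < k) f i * B ^ i.
Definition dig c y := (c %/ B ^ y) %% B.

Lemma mk_recr k f : mk k.+1 f = mk k f + f k * B ^ k.
Proof. by rewrite /mk big_ord_recr. Qed.

Lemma mk_lt k f : (forall i, i < k -> f i < B) -> mk k f < B ^ k.
Proof.
elim: k => [|k IH] fB; first by rewrite /mk big_ord0.
rewrite mk_recr expnS.
have h1 : mk k f < B ^ k by apply: IH => i ik; apply: fB; lia.
have h2 : f k * B ^ k <= l.+1 * B ^ k.
  by rewrite leq_mul2r; apply/orP; right; rewrite -ltnS; apply: fB.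
lia.
Qed.

Lemma dig_mk k f y :
  (forall i, i < k -> f i < B) -> y < k -> dig (mk k f) y = f y.
Proof.
elim: k => [//|k IH] fB; rewrite ltnS leq_eqVlt mk_recr => /orP[/eqP ->|yk].
  rewrite /dig addnC divnMDl ?expn_gt0 // divn_small ?addn0.
    by rewrite modn_small ?fB.
  by apply: mk_lt => i ik; apply: fB; lia.
rewrite -[RHS]IH //; last by move=> i ik; apply: fB; lia.
rewrite /dig.
have -> : f k * B ^ k = f k * B ^ (k - y.+1) * B * B ^ y.
  by rewrite -!mulnA -expnS -expnD subnK.
by rewrite addnC divnMDl ?expn_gt0 // modnMDl.
Qed.

Lemma dig_lt c y : dig c y < B.
Proof. by rewrite /dig ltn_pmod. Qed.

(** Colouring [v] raises the span to the lower bound of [v], so the excess of [y] becomes the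
    maximum of [dig c y - dig c v] and [W v y]. The comparison keeps the subtraction nonnegative, as
    the wrapping arithmetic of the machine requires. *)
Definition bump c v y :=
  if (y == v) || (dig c y == 0) then 0
  else if dig c v + W v y < dig c y then (dig c y - dig c v).+1
  else (W v y).+1.

Definition succ c v := mk n (bump c v).

Lemma bump_lt c v y : dig c v != 0 -> bump c v y < B.
Proof.
move=> dv; rewrite /bump; have := W_le v y; have := dig_lt c y.
by case: ifP => // _; case: ifP => //; lia.
Qed.

Lemma dig_succ c v y :
  dig c v != 0 -> y < n -> dig (succ c v) y = bump c v y.
Proof. by move=> dv yn; rewrite dig_mk // => i _; apply: bump_lt. Qed.

Lemma succ_lt c v : dig c v != 0 -> succ c v < B ^ n.
Proof. by move=> dv; apply: mk_lt => i _; apply: bump_lt. Qed.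

(* A state is a number in base l + 2: digit y is 0 if y is coloured, and otherwise
   1 plus the excess of the lower bound for y over the current span.  Lists of
   vertices are in reverse order of colouring: the head is coloured last. *)
Fixpoint code (vs : seq nat) :=
  if vs is v :: vs' then succ (code vs') v else mk n (fun=> 1).

(** Every increment is read off the code, so partial colourings with equal codes have the same
    continuations at the same cost; this justifies merging them. *)
Fixpoint span (vs : seq nat) :=
  if vs is v :: vs' then span vs' + dig (code vs') v - 1 else 1.

(** The term [lb vs' v + W v y] is at least the colour of [v], so the bounds also force the colours
    to be nondecreasing. *)
Fixpoint lb (vs : seq nat) (y : nat) :=
  if vs is v :: vs' then maxn (lb vs' y) (lb vs' v + W v y) else 1.

Fixpoint colour (vs : seq nat) (x : nat) :=
  if vs is v :: vs' then if x == v then lb vs' v else colour vs' x else 0.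

Definition ordering (vs : seq nat) := uniq vs && all (ltn^~ n) vs.

Lemma ordering_cons v vs :
  ordering (v :: vs) = [&& v \notin vs, v < n & ordering vs].
Proof. by rewrite /ordering /=; do !case: (_ \in _); case: (v < n); case: uniq. Qed.

Lemma dig_code vs y : ordering vs -> y < n -> (dig (code vs) y == 0) = (y \in vs).
Proof.
elim: vs y => [|v vs IH] y; first by move=> _ yn; rewrite dig_mk.
rewrite ordering_cons => /and3P[vvs vn ovs] yn /=.
rewrite dig_succ ?IH // /bump IH // inE.
by case: (_ || _) => //; case: ifP.
Qed.

Lemma code_lt vs : ordering vs -> code vs < B ^ n.
Proof.
case: vs => [|v vs]; first by move=> _; apply: mk_lt.
rewrite ordering_cons => /and3P[vvs vn ovs].
by apply: succ_lt; rewrite dig_code.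
Qed.

Lemma mk_dig vs : ordering vs -> mk n (dig (code vs)) = code vs.
Proof.
case: vs => [|v vs] o; first by apply: eq_bigr => i _; rewrite dig_mk.
move: o; rewrite ordering_cons => /and3P[vvs vn ovs].
by apply: eq_bigr => i _; rewrite dig_succ ?dig_code.
Qed.

(** Both branches of [bump] compute the maximum in [lb], measured from the new span [lb vs v]. *)
Lemma dig_lb vs y :
  ordering vs -> y < n -> y \notin vs -> dig (code vs) y + span vs = (lb vs y).+1.
Proof.
elim: vs y => [|v vs IH] y; first by move=> _ yn _; rewrite dig_mk.
rewrite ordering_cons inE negb_or => /and3P[vvs vn ovs] yn /andP[yv yvs] /=.
have dv : dig (code vs) v != 0 by rewrite dig_code.
have dy : dig (code vs) y != 0 by rewrite dig_code.
have ev := IH _ ovs vn vvs; have ey := IH _ ovs yn yvs.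
rewrite dig_succ // /bump (negPf yv) (negPf dy) /=.
by case: ifP => h; lia.
Qed.

Lemma span_cons v vs : ordering (v :: vs) -> span (v :: vs) = lb vs v.
Proof.
rewrite ordering_cons => /and3P[vvs vn ovs] /=.
by have := dig_lb ovs vn vvs; lia.
Qed.

Lemma span_le_lb vs y :
  ordering vs -> y < n -> y \notin vs -> span vs <= lb vs y.
Proof.
move=> ovs yn yvs; have := dig_lb ovs yn yvs.
have : dig (code vs) y != 0 by rewrite dig_code.
lia.
Qed.

Lemma span_bound vs : ordering vs -> span vs <= (size vs * l).+1.
Proof.
elim: vs => [//|v vs IH] /=; rewrite ordering_cons => /and3P[vvs vn ovs].
have := IH ovs; have := dig_lt (code vs) v; rewrite mulSn; lia.
Qed.

Lemma ordering_size vs : ordering vs -> size vs <= n.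
Proof.
case/andP=> u /allP vn; rewrite -[n](size_iota 0).
by apply: uniq_leq_size u _ => i /vn; rewrite mem_iota.
Qed.

(** * Greedy colourings are proper, and optimal for a suitable order *)

Lemma lb_gt0 vs y : 0 < lb vs y.
Proof. by elim: vs => //= v vs IH; rewrite leq_max IH. Qed.

Lemma colour_bounds vs x : ordering vs -> x \in vs -> 1 <= colour vs x <= span vs.
Proof.
elim: vs => // v vs IH ov; rewrite span_cons // inE /=.
case: eqP => [_|_] /=; first by rewrite lb_gt0 leqnn.
move: ov; rewrite ordering_cons => /and3P[vvs vn ovs] /(IH ovs) /andP[-> /=].
by move/leq_trans; apply; apply: span_le_lb.
Qed.

Lemma lb_colour vs x y :
  ordering vs -> x \in vs -> colour vs x + W x y <= lb vs y.
Proof.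
elim: vs => // v vs IH; rewrite ordering_cons inE => /and3P[vvs vn ovs] /=.
case: eqP => [-> _|_ /= /(IH ovs) h]; first exact: leq_maxr.
exact: leq_trans h (leq_maxl _ _).
Qed.

(** The later of two vertices gets its lower bound as colour, which respects every earlier vertex;
    symmetry of [W] covers the case where [x] is the later one. *)
Lemma colour_proper (vs : seq nat) (x y : nat) :
  (forall x y, x < n -> y < n -> W x y = W y x) ->
  ordering vs -> x \in vs -> y \in vs -> x != y ->
  W x y <= `|colour vs x - colour vs y|%N.
Proof.
move=> Wsym; elim: vs => // v vs IH; rewrite ordering_cons => /and3P[vvs vn ovs].
have vsn z (zvs : z \in vs) : z < n by case/andP: ovs => _ /allP; apply.
rewrite !inE /=; case: (eqVneq x v) => [->|_]; case: (eqVneq y v) => [->|_] //=.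
- move=> _ yvs _; rewrite (Wsym _ _ vn (vsn _ yvs)).
  by have := lb_colour v ovs yvs; lia.
- by move=> xvs _ _; have := lb_colour v ovs xvs; lia.
- by move=> xvs yvs xy; apply: IH.
Qed.

(** By induction [lb vs v + W v y <= c v + W v y <= c y]; the last inequality holds because
    sortedness gives [c v <= c y], which opens the absolute value. *)
Lemma lb_min (c : nat -> nat) vs y :
  (forall x, x < n -> 1 <= c x) ->
  (forall x y, x < n -> y < n -> x != y -> W x y <= `|c x - c y|%N) ->
  ordering (y :: vs) -> sorted (fun x y => c y <= c x) (y :: vs) ->
  lb vs y <= c y.
Proof.
move=> c1 cW; have tr : transitive (fun x y => c y <= c x).
  by move=> x1 x2 x3 h1 h2; apply: leq_trans h2 h1.
elim: vs y => [|v vs IH] y oy sy.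
  by apply: c1; move: oy; rewrite ordering_cons => /and3P[].
have yn : y < n by move: oy; rewrite ordering_cons => /and3P[].
have [yv oyvs ov] : [/\ y != v, ordering (y :: vs) & ordering (v :: vs)].
  move: oy; rewrite !ordering_cons inE negb_or.
  by case/and3P=> /andP[-> ->] -> /and3P[-> -> ->].
have vn : v < n by move: ov; rewrite ordering_cons => /and3P[].
have /andP[cvy sv] : (c v <= c y) && sorted (fun x y => c y <= c x) (v :: vs) by [].
(* The maximum also contains [lb vs y], so the induction hypothesis is needed for [y] with [v] left
   out. *)
have syvs : sorted (fun x y => c y <= c x) (y :: vs).
  apply: (subseq_sorted tr) sy.
  by have := subseq_cons vs v; rewrite /= eqxx.
rewrite /= geq_max IH //=; have := IH _ ov sv.
by have := cW _ _ vn yn; rewrite eq_sym yv; lia.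
Qed.


Lemma span_min (c : nat -> nat) s : 0 < n ->
  (forall x, x < n -> 1 <= c x <= s) ->
  (forall x y, x < n -> y < n -> x != y -> W x y <= `|c x - c y|%N) ->
  exists vs, [/\ ordering vs, size vs = n & span vs <= s].
Proof.
(* The head is coloured last, so the vertices are sorted by decreasing colour. *)
move=> n0 cs cW; pose vs := sort (fun x y => c y <= c x) (iota 0 n).
have ovs : ordering vs.
  rewrite /ordering sort_uniq iota_uniq all_sort.
  by apply/allP => i; rewrite mem_iota.
have svs : size vs = n by rewrite size_sort size_iota.
exists vs; split=> //; have : sorted (fun x y => c y <= c x) vs.
  by apply: sort_sorted => x y; apply: leq_total.
case: vs ovs svs => [_ /esym n00|v vs ovs _ srt]; first by rewrite n00 in n0.
rewrite span_cons //; have vn : v < n.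
  by move: ovs; rewrite ordering_cons => /and3P[].
have /andP[_ cv] := cs _ vn; apply: leq_trans cv.
by apply: lb_min cW ovs srt => x /cs/andP[].
Qed.

(** * Counting the states *)

Lemma ordering_full vs u : ordering vs -> size vs = n -> u < n -> u \in vs.
Proof.
case/andP=> uvs /allP vn svs un.
have sub : {subset vs <= iota 0 n} by move=> j /vn; rewrite mem_iota.
have [] := uniq_min_size uvs sub; first by rewrite size_iota svs.
by move=> _ ->; rewrite mem_iota.
Qed.

(** Unfolds the recursion so that the bound depends only on the span and on the coloured vertices
    with their colours. *)
Lemma lb_max vs y : ordering vs -> y < n -> y \notin vs ->
  lb vs y = maxn (span vs) (\max_(x <- vs) (colour vs x + W x y)).
Proof.
elim: vs => [|v vs IH] ovs' yn; first by rewrite big_nil.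
rewrite inE negb_or => /andP[yv yvs].
have := ovs'; rewrite ordering_cons => /and3P[vvs vn ovs].
rewrite span_cons // big_cons [lb _ y]/= IH // [colour _ v]/= eqxx.
have -> : \max_(x <- vs) (colour (v :: vs) x + W x y) =
          \max_(x <- vs) (colour vs x + W x y).
  by apply: eq_big_seq => x xvs /=; case: eqP => // e; rewrite -e xvs in vvs.
by have := span_le_lb ovs vn vvs; lia.
Qed.

(** Subtracting the span in [lb_max] leaves the distances of the colours to the span. Since
    [W x y <= l], the difference is 0 once the distance reaches [l], so truncation there is
    harmless. *)
Lemma dig_max vs y : ordering vs -> y < n -> y \notin vs ->
  dig (code vs) y =
    (\max_(x <- vs) (W x y - minn l (span vs - colour vs x))).+1.
Proof.
move=> ovs yn yvs; have := dig_lb ovs yn yvs; rewrite lb_max // => h.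
(* Induct on a sublist, so that [span vs] and [colour vs] stay fixed. *)
suff max_sub (s : seq nat) : {subset s <= vs} ->
    \max_(x <- s) (W x y - minn l (span vs - colour vs x)) =
    \max_(x <- s) (colour vs x + W x y) - span vs by rewrite max_sub //; lia.
elim: s => [|x s IH] svs; first by rewrite !big_nil.
rewrite !big_cons IH => [|z zs]; last by apply: svs; rewrite inE zs orbT.
have := W_le x y; have /andP[_] := colour_bounds ovs (svs x (mem_head _ _)).
lia.
Qed.

Lemma bigmax_ordering vs (F : nat -> nat) : ordering vs ->
  \max_(x <- vs) F x = \max_(i < n | (i : nat) \in vs) F i.
Proof.
move=> /andP[u /allP vn].
rewrite -(big_mkord (fun i => i \in vs)) -[RHS]big_filter; apply: perm_big.
apply: uniq_perm; rewrite ?filter_uniq ?iota_uniq // => i.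
rewrite mem_filter mem_index_iota /=.
by case: (boolP (i \in vs)) => // /vn.
Qed.

Local Notation m := n./2.

(* The vector h lists truncated distances to the span on X if X is the smaller
   side, lower bounds on the complement of X otherwise. *)
Definition decode (Xh : {set 'I_n} * m.-tuple 'I_l.+1) : nat :=
  let: (X, h) := Xh in
  let f Z (i : 'I_n) : nat := nth ord0 h (index i (enum (pred_of_set Z))) in
  \sum_(y < n)
    (if y \in X then 0
     else if #|X| <= m then (\max_(x < n | x \in X) (W x y - f X x)).+1
     else (f (~: X) y).+1) * B ^ y.

(** The vector lists the values along [enum Z]; surplus places are filled with [ord0]. *)
Lemma small_set_vector (Z : {set 'I_n}) (g : 'I_n -> 'I_l.+1) : #|Z| <= m ->
  exists h : m.-tuple 'I_l.+1,
    {in Z, forall i, nth ord0 h (index i (enum Z)) = g i}.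
Proof.
move=> Zm; exists [tuple nth ord0 (map g (enum Z)) i | i < m] => i iZ.
have iZ' : i \in enum Z by rewrite mem_enum.
have lt : index i (enum Z) < m.
  by apply: leq_trans Zm; rewrite cardE index_mem.
rewrite -[index i _]/(val (Ordinal lt)) nth_mktuple /=.
by rewrite (nth_map i) ?index_mem // nth_index.
Qed.

Lemma code_decode vs : ordering vs -> exists Xh, code vs = decode Xh.
Proof.
move=> ovs; pose X := [set i : 'I_n | (i : nat) \in vs].
have cX (i : 'I_n) : (i \in X) = ((i : nat) \in vs) by rewrite inE.
have [Xm|Xm] := leqP #|X| m.
  have [h hP] := small_set_vector
    (fun i => inord (minn l (span vs - colour vs i))) Xm.
  exists (X, h); rewrite /decode Xm -(mk_dig ovs) /mk.
  apply: eq_bigr => y _; congr (_ * _); rewrite cX.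
  case: ifP => [yvs|/negbT yvs]; first by apply/eqP; rewrite dig_code.
  rewrite dig_max // bigmax_ordering //; congr _.+1.
  apply: eq_big => i; rewrite ?cX // -cX => iX; rewrite hP // inordK //; lia.
(* More than [n./2] coloured vertices leave at most [n./2] uncoloured, also for odd [n]. *)
have cXm : #|~: X| <= m by have := cardsC X; rewrite card_ord; lia.
have [h hP] := small_set_vector
  (fun i => inord (dig (code vs) i).-1) cXm.
exists (X, h); rewrite /decode leqNgt Xm -(mk_dig ovs) /mk.
apply: eq_bigr => y _; congr (_ * _); rewrite cX.
case: ifP => [yvs|/negbT yvs]; first by apply/eqP; rewrite dig_code.
(* Digits outside [X] lie in [1, ..., l + 1], so their predecessors fit into ['I_l.+1]. *)
rewrite hP ?inE //; have := dig_lt (code vs) y.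
have : dig (code vs) y != 0 by rewrite dig_code.
by move=> d0 dB; rewrite inordK; lia.
Qed.

(** All codes lie in the image of [decode], and the bound is the cardinality of its domain. *)
Lemma count_codes (s : seq nat) : uniq s ->
  (forall c, c \in s -> exists2 vs, ordering vs & code vs = c) ->
  size s <= 2 ^ n * l.+1 ^ m.
Proof.
move=> us sP.
have -> : 2 ^ n * l.+1 ^ m = size (map decode (enum predT)).
  rewrite size_map -cardT card_prod card_tuple card_ord.
  by rewrite -cardsT -powersetT card_powerset cardsT card_ord.
apply: uniq_leq_size us _ => c /sP[vs ovs <-].
by have [Xh ->] := code_decode ovs; apply: map_f; rewrite mem_enum.
Qed.

End Codes.

(** * Breadth-first search through the states *)

(* Span (0 if the state is unvisited), predecessor state and last coloured vertex
   of the best partial colouring found so far, and the queue of all visited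
   states. *)
Record table :=
  Table { tD : nat -> nat; tP : nat -> nat; tV : nat -> nat; tQ : seq nat }.

Definition table0 := Table (fun=> 0) (fun=> 0) (fun=> 0) [::].

(** A visited state is not queued again when its span improves: improvements come from the preceding
    layer only, hence before the state is expanded. *)
Definition insert S c' d c v :=
  if tD S c' == 0 then
    Table (upd (tD S) c' d) (upd (tP S) c' c) (upd (tV S) c' v)
          (rcons (tQ S) c')
  else if d < tD S c' then
    Table (upd (tD S) c' d) (upd (tP S) c' c) (upd (tV S) c' v) (tQ S)
  else S.

Section Search.
Variables (n l : nat) (W : nat -> nat -> nat).
Hypothesis W_le : forall x y, W x y <= l.

Local Notation dig := (dig l).
Local Notation succ := (succ n l W).
Local Notation code := (code n l W).
Local Notation span := (span n l W).
Local Notation ordering := (ordering n).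

Definition relax S c d v :=
  if dig c v == 0 then S else insert S (succ c v) (d + dig c v - 1) c v.

Fixpoint expand k S c d :=
  if k is k'.+1 then relax (expand k' S c d) c d k' else S.

Fixpoint bfs k :=
  if k is k'.+1 then
    let S := bfs k' in
    let c := nth 0 (tQ S) k' in expand n S c (tD S c)
  else insert table0 (code nil) 1 0 0.

(** The number of coloured vertices. It grows by exactly one along each edge, whereas the span may
    grow by any amount up to [l]; this is why a plain queue suffices. *)
Definition layer c := count (fun i => dig c i == 0) (iota 0 n).

Lemma layer_code vs : ordering vs -> layer (code vs) = size vs.
Proof.
move=> ovs; have /andP[u /allP vn] := ovs.
rewrite /layer (eq_in_count (a2 := mem vs)); last first.
  by move=> i; rewrite mem_iota => /= ni; rewrite dig_code.
rewrite -size_filter; apply: perm_size; apply: uniq_perm => //.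
  by rewrite filter_uniq ?iota_uniq.
move=> i; rewrite mem_filter mem_iota /=.
by case: (boolP (i \in vs)) => // /vn /= ->.
Qed.

Lemma ordering_succ vs v :
  ordering vs -> v < n -> dig (code vs) v != 0 -> ordering (v :: vs).
Proof. by move=> ovs vn; rewrite dig_code // ordering_cons vn ovs => ->. Qed.

Lemma layer_succ vs v : ordering vs -> v < n -> dig (code vs) v != 0 ->
  layer (succ (code vs) v) = (layer (code vs)).+1.
Proof.
move=> ovs vn dv; have ov := ordering_succ ovs vn dv.
by have := layer_code ov; rewrite (layer_code ovs).
Qed.

(* The states before position h of the queue are expanded, and the one at h is
   expanded along the vertices below v. *)
Record search_inv (S : table) (h v : nat) : Prop := SearchInv {
  inv_uniq : uniq (tQ S);
  inv_visited : forall c, (tD S c != 0) = (c \in tQ S);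
  inv_head : [/\ 0 < size (tQ S), nth 0 (tQ S) 0 = code nil
               & tD S (code nil) = 1];
  inv_reach : forall c, c \in tQ S -> exists2 vs, ordering vs & code vs = c;
  inv_sorted : forall i j, i <= j < size (tQ S) ->
    layer (nth 0 (tQ S) i) <= layer (nth 0 (tQ S) j);
  inv_layer : h < size (tQ S) -> forall c, c \in tQ S ->
    layer c <= (layer (nth 0 (tQ S) h)).+1;
  inv_parent : forall c, c \in tQ S -> c != code nil ->
    [/\ tP S c \in tQ S, tV S c < n, dig (tP S c) (tV S c) != 0,
        c = succ (tP S c) (tV S c)
      & tD S c = tD S (tP S c) + dig (tP S c) (tV S c) - 1];
  inv_relaxed : forall i u, i < size (tQ S) -> u < n ->
    i < h \/ i = h /\ u < v -> dig (nth 0 (tQ S) i) u != 0 ->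
    succ (nth 0 (tQ S) i) u \in tQ S /\
    tD S (succ (nth 0 (tQ S) i) u) <=
      tD S (nth 0 (tQ S) i) + dig (nth 0 (tQ S) i) u - 1 }.

Lemma insertE S c' d c v (S' := insert S c' d c v) :
  (forall x, (tD S x != 0) = (x \in tQ S)) ->
  [/\ tQ S' = if c' \in tQ S then tQ S else rcons (tQ S) c',
      forall x, x != c' -> [/\ tD S' x = tD S x, tP S' x = tP S x
                             & tV S' x = tV S x]
    & [/\ c' \in tQ S, S' = S & tD S c' <= d] \/
      [/\ tD S' c' = d, tP S' c' = c, tV S' c' = v
        & c' \in tQ S -> d <= tD S c'] ].
Proof.
move=> vis; have := vis c'; rewrite /S' /insert; case: eqP => [e|ne] /= <-.
  split => //; first by move=> x xc; rewrite /upd (negPf xc).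
  by right; rewrite /upd eqxx.
case: ltnP => h; last by split => //; left.
split => //=; first by move=> x xc; rewrite /upd (negPf xc).
by right; rewrite /upd eqxx; split=> // _; apply: ltnW.
Qed.

(** The successor lies exactly one layer beyond [c]. Hence no state up to position [h] and no
    predecessor of a queued state is overwritten, and the queue stays sorted by layers. *)
Lemma search_inv_relax S h v (c := nth 0 (tQ S) h) (S' := relax S c (tD S c) v) :
  search_inv S h v -> h < size (tQ S) -> v < n ->
  [/\ search_inv S' h v.+1, h < size (tQ S'), nth 0 (tQ S') h = c
    & tD S' c = tD S c].
Proof.
move=> inv hQ vn; have [un vis [Q0 Qh c01] rch srt lay par rlx] := inv.
rewrite {}/S' /relax; case: (eqVneq (dig c v) 0) => [d0|dv].
  split=> //; split=> // i u iQ un' [ih|[ih]].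
    by apply: rlx => //; left.
  rewrite ltnS leq_eqVlt => /orP[/eqP -> du|uv]; last by apply: rlx => //; right.
  by rewrite ih -/c d0 in du.
have cQ : c \in tQ S by apply: mem_nth.
have [vs ovs evs] := rch _ cQ.
set c' := succ c v; have ov : ordering (v :: vs).
  by apply: ordering_succ; rewrite ?evs.
have ec' : code (v :: vs) = c' by rewrite /= evs.
have lc' : layer c' = (layer c).+1 by rewrite /c' -evs layer_succ ?evs.
set nd := tD S c + dig c v - 1.
(* A span is never 0, which marks unvisited states. *)
have nd0 : nd != 0 by have := vis c; rewrite cQ /nd; lia.
case: (insertE c' nd c v vis); set S' := insert _ _ _ _ _ => eQ same new.
have subQ x : x \in tQ S -> x \in tQ S'.
  by rewrite eQ; case: ifP => // _ xQ; rewrite mem_rcons inE xQ orbT.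
have c'Q : c' \in tQ S'.
  by rewrite eQ; case: ifP => // _; rewrite mem_rcons mem_head.
have memQ x : x \in tQ S' -> x = c' \/ x \in tQ S.
  rewrite eQ; case: ifP => _; first by right.
  by rewrite mem_rcons inE => /orP[/eqP|]; [left|right].
have lowc x : layer x <= layer c -> x != c'.
  by move=> lx; apply/eqP => e; move: lx; rewrite e lc' ltnn.
have nthQ i : i < size (tQ S) -> nth 0 (tQ S') i = nth 0 (tQ S) i.
  by move=> iQ; rewrite eQ; case: ifP => // _; rewrite nth_rcons iQ.
have sizeQ : size (tQ S) <= size (tQ S').
  by rewrite eQ; case: ifP => // _; rewrite size_rcons.
have sizeQ' i : i < size (tQ S') ->
    i < size (tQ S) \/ i = size (tQ S) /\ nth 0 (tQ S') i = c'.
  rewrite eQ; case: ifP => _; first by left.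
  rewrite size_rcons ltnS leq_eqVlt => /orP[/eqP ->|]; last by left.
  by right; rewrite nth_rcons ltnn eqxx.
have D'c : tD S' c = tD S c by have [] := same _ (lowc _ (leqnn _)).
have layQ x : x \in tQ S' -> layer x <= (layer c).+1.
  by case/memQ => [->|/lay]; [rewrite lc' | apply].
have D'c' : tD S' c' <= nd by case: new => [[_ -> ]|[->]].
have D'le x : x \in tQ S -> tD S' x <= tD S x.
  case: (eqVneq x c') => [->|/same[-> //]].
  by case: new => [[_ ->]|[-> _ _]] //; apply.
have c0c' : code nil != c' by apply: lowc; rewrite layer_code.
split=> //; [|exact: leq_trans sizeQ|exact: nthQ].
split.
- by rewrite eQ; case: ifP => // nin; rewrite rcons_uniq nin.
- move=> x; case: (eqVneq x c') => [->|xc'].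
    rewrite c'Q; case: new => [[iQ -> _]|[-> //]].
    by rewrite vis iQ.
  have [-> _ _] := same _ xc'; rewrite vis eQ; case: ifP => // _.
  by rewrite mem_rcons inE (negPf xc').
- split; rewrite ?nthQ ?(leq_trans Q0) //.
  by have [-> _ _] := same _ c0c'.
- move=> x /memQ[->|]; last exact: rch.
  by exists (v :: vs).
- move=> i j /andP[ij jQ]; have [jQ'|[ej ->]] := sizeQ' _ jQ.
    have iQ' := leq_ltn_trans ij jQ'.
    by rewrite !nthQ // srt // ij.
  by rewrite lc'; apply: layQ; apply: mem_nth; apply: leq_ltn_trans ij jQ.
- by move=> _ x xQ; rewrite nthQ // layQ.
- move=> x xQ xc0; case: (eqVneq x c') => [ex|xc'].
    case: new => [[iQ -> _]|[eD eP eV _]]; first by apply: par xc0; rewrite ex.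
    by rewrite ex eD eP eV D'c; split=> //; apply: subQ.
  have xQS : x \in tQ S by case: (memQ _ xQ) => // e; rewrite e eqxx in xc'.
  have [-> -> ->] := same _ xc'; have [pQ Vn dp ex ->] := par _ xQS xc0.
  split=> //; first exact: subQ.
  (* By [inv_layer] the predecessor of [x] lies at most in the layer of [c]. *)
  have pc' : tP S x != c'.
    apply: lowc; have [ws ows ews] := rch _ pQ.
    by have := lay hQ _ xQS; rewrite {1}ex -ews layer_succ ?ews.
  by have [-> _ _] := same _ pc'.
- move=> i u iQ un' ihu.
  have {}iQ : i < size (tQ S) by case: ihu; lia.
  rewrite nthQ //.
  have li : layer (nth 0 (tQ S) i) <= layer c by apply: srt; case: ihu; lia.
  have [-> _ _] := same _ (lowc _ li).
  move=> du; case: ihu => [ih|[ih]].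
    have [sQ sD] := rlx i u iQ un' (or_introl ih) du.
    by split; [apply: subQ | apply: leq_trans sD; apply: D'le].
  rewrite ltnS leq_eqVlt => /orP[/eqP uv|uv].
    by rewrite uv ih; split.
  have [sQ sD] := rlx i u iQ un' (or_intror (conj ih uv)) du.
  by split; [apply: subQ | apply: leq_trans sD; apply: D'le].
Qed.

Lemma search_inv_expand S h k (c := nth 0 (tQ S) h)
    (S' := expand k S c (tD S c)) :
  search_inv S h 0 -> h < size (tQ S) -> k <= n ->
  [/\ search_inv S' h k, h < size (tQ S'), nth 0 (tQ S') h = c
    & tD S' c = tD S c].
Proof.
move=> inv hQ; rewrite {}/S'; elim: k => [//|k IH] kn /=.
have [inv' hQ' ec eD] := IH (ltnW kn).
have := search_inv_relax inv' hQ' kn; rewrite ec eD.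
by case=> *; split.
Qed.

Lemma search_inv_next S h :
  search_inv S h n -> h < size (tQ S) -> search_inv S h.+1 0.
Proof.
move=> [un vis hd rch srt lay par rlx] hQ; split=> //.
- move=> hQ' c /(lay hQ) /leq_trans; apply; rewrite ltnS.
  by apply: srt; rewrite leqnSn.
- move=> i u iQ un' [ih|[_ //]]; apply: rlx => //.
  by move: ih; rewrite ltnS leq_eqVlt => /orP[/eqP ->|]; [right|left].
Qed.

Lemma search_inv0 : search_inv (bfs 0) 0 0.
Proof.
rewrite /bfs /insert [tD _ _ == _]/=; split=> //=.
- by move=> c; rewrite /upd inE; case: (c == _).
- by rewrite /upd eqxx.
- by move=> c; rewrite inE => /eqP ->; exists [::].
- by move=> i j ij; have [-> ->] : i = 0 /\ j = 0 by lia.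
- by move=> _ c; rewrite inE => /eqP ->.
- by move=> c; rewrite inE => /eqP ->; rewrite eqxx.
- by move=> i u _ _ [|[]].
Qed.

Lemma search_inv_bfs k : search_inv (bfs k) k 0 -> k < size (tQ (bfs k)) ->
  search_inv (bfs k.+1) k.+1 0 /\ k < size (tQ (bfs k.+1)).
Proof.
move=> inv kQ; have [inv' kQ' _ _] := search_inv_expand inv kQ (leqnn n).
by split=> //; apply: search_inv_next.
Qed.

(** Follow the ordering from the empty colouring: each of its edges has been relaxed, so the entries
    never exceed the spans along it. *)
Lemma final_le S vs : search_inv S (size (tQ S)) 0 -> ordering vs ->
  code vs \in tQ S /\ tD S (code vs) <= span vs.
Proof.
move=> [un vis [Q0 Qh c01] rch srt lay par rlx].
elim: vs => [_|v vs IH]; first by rewrite c01 -Qh mem_nth.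
move=> ov; have := ov; rewrite ordering_cons => /and3P[vvs vn ovs].
have [cQ cD] := IH ovs.
have dv : dig (code vs) v != 0 by rewrite dig_code.
have := rlx (index (code vs) (tQ S)) v.
rewrite index_mem nth_index // => /(_ cQ vn (or_introl cQ) dv)[sQ sD] /=.
by split=> //; apply: leq_trans sD _; lia.
Qed.

Fixpoint traced (S : table) (vs : seq nat) : Prop :=
  if vs is v :: vs' then
    [/\ tP S (code vs) = code vs', tV S (code vs) = v,
        tD S (code vs) = span vs & traced S vs']
  else tD S (code nil) = 1.

(** Predecessors go down one layer at a time to the empty colouring, and the equalities in
    [inv_parent] add up to the span of this path. *)
Lemma search_trace S h u c : search_inv S h u -> c \in tQ S ->
  exists vs, [/\ ordering vs, code vs = c, tD S c = span vs & traced S vs].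
Proof.
move=> [un vis [Q0 Qh c01] rch srt lay par rlx].
have [k] := ubnP (layer c); elim: k c => // k IH c; rewrite ltnS => lk cQ.
case: (eqVneq c (code nil)) => [->|c0]; first by exists [::].
have [pQ Vn dp ec eD] := par _ cQ c0; have [ws ows ews] := rch _ pQ.
have lp : layer (tP S c) < k.
  by apply: leq_trans lk; rewrite {2}ec -ews layer_succ ?ews.
have [vs [ovs evs sD tr]] := IH _ lp pQ.
exists (tV S c :: vs); rewrite /= evs -ec -sD; split=> //.
by apply: ordering_succ; rewrite ?evs.
Qed.


Lemma search_bound S h u c : search_inv S h u -> c \in tQ S ->
  c < l.+2 ^ n /\ tD S c <= (n * l).+1.
Proof.
move=> inv cQ; have [vs [ovs <- -> _]] := search_trace inv cQ.
split; first exact: code_lt.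
apply: leq_trans (span_bound l W ovs) _.
by rewrite ltnS leq_mul2r (ordering_size ovs) orbT.
Qed.

(** Complete colourings thus share a single state, the target of the search. *)
Lemma code_full vs : ordering vs -> size vs = n -> code vs = 0.
Proof.
move=> ovs svs; rewrite -(mk_dig W_le ovs) /mk big1 // => i _.
suff /eqP -> : dig (code vs) i == 0 by [].
by rewrite dig_code // (ordering_full ovs).
Qed.

Lemma final_optimal S : search_inv S (size (tQ S)) 0 -> exists vs,
  [/\ ordering vs, size vs = n, traced S vs, code vs = 0 & tD S 0 = span vs] /\
  forall vs', ordering vs' -> size vs' = n -> span vs <= span vs'.
Proof.
move=> inv; have oi : ordering (iota 0 n).
  rewrite /ordering iota_uniq; apply/allP => i; by rewrite mem_iota.
have [] := final_le inv oi; rewrite code_full ?size_iota // => Q0 _.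
have [vs [ovs evs sD tr]] := search_trace inv Q0.
exists vs; split; first split=> //.
  rewrite -(layer_code ovs) evs -(code_full oi) ?size_iota //.
  by rewrite layer_code // size_iota.
move=> ws ows /(code_full ows) ews; rewrite -sD -ews.
by have [] := final_le inv ows.
Qed.

End Search.

(** * A program logic with step counts for the word RAM *)

Definition post := nat -> seq nat -> (nat -> nat) -> Prop.

(** A total-correctness triple whose postcondition receives the step count. Registers form a list
    with default 0, so that updates compute; agreement is pointwise, which avoids function
    extensionality. *)
Definition runs b p (rs : seq nat) (m : nat -> nat) (Q : post) : Prop :=
  forall st, regs st =1 nth 0 rs -> Defs.mem st =1 m ->
  exists t st' rs' m',
    [/\ exec b p st t st', regs st' =1 nth 0 rs', Defs.mem st' =1 m' & Q t rs' m'].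

Section Rules.
Variable b : nat.
Implicit Types (Q : post) (rs : seq nat) (m : nat -> nat).

Lemma runs_conseq p rs m Q Q' :
  (forall t rs' m', Q t rs' m' -> Q' t rs' m') ->
  runs b p rs m Q -> runs b p rs m Q'.
Proof.
move=> QQ' H st e1 e2; have [t [st' [rs' [m' [? ? ? ?]]]]] := H st e1 e2.
by exists t, st', rs', m'; split=> //; apply: QQ'.
Qed.

Lemma runs_skip rs m Q : Q 1 rs m -> runs b Skip rs m Q.
Proof. by move=> q st *; exists 1, st, rs, m; split=> //; constructor. Qed.

Lemma upd_set_nth (f : nat -> nat) rs r v :
  f =1 nth 0 rs -> upd f r v =1 nth 0 (set_nth 0 rs r v).
Proof. by move=> e i; rewrite nth_set_nth /= /upd; case: eqP. Qed.

Lemma runs_const r k rs m Q :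
  k < 2 ^ b -> Q 1 (set_nth 0 rs r k) m -> runs b (Const r k) rs m Q.
Proof.
move=> kb q st e1 e2.
exists 1, (set_reg st r (k %% 2 ^ b)), (set_nth 0 rs r k), m; split=> //.
  by constructor.
by rewrite modn_small //; apply: upd_set_nth.
Qed.

Lemma runs_op o r r1 r2 v rs m Q :
  eval_op b o (nth 0 rs r1) (nth 0 rs r2) = v ->
  Q 1 (set_nth 0 rs r v) m -> runs b (Op r o r1 r2) rs m Q.
Proof.
move=> ev q st e1 e2.
exists 1, (set_reg st r (eval_op b o (regs st r1) (regs st r2))).
exists (set_nth 0 rs r v), m; split=> //; first by constructor.
by rewrite !e1 ev; apply: upd_set_nth.
Qed.

Lemma runs_add r r1 r2 rs m Q :
  nth 0 rs r1 + nth 0 rs r2 < 2 ^ b ->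
  Q 1 (set_nth 0 rs r (nth 0 rs r1 + nth 0 rs r2)) m ->
  runs b (Op r OAdd r1 r2) rs m Q.
Proof. by move=> h; apply: runs_op; apply: modn_small. Qed.

Lemma runs_sub r r1 r2 rs m Q :
  nth 0 rs r2 <= nth 0 rs r1 -> nth 0 rs r1 < 2 ^ b ->
  Q 1 (set_nth 0 rs r (nth 0 rs r1 - nth 0 rs r2)) m ->
  runs b (Op r OSub r1 r2) rs m Q.
Proof.
move=> h1 h2; apply: runs_op => /=.
have -> : nth 0 rs r1 + (2 ^ b - nth 0 rs r2) =
          nth 0 rs r1 - nth 0 rs r2 + 2 ^ b by lia.
by rewrite modnDr modn_small //; lia.
Qed.

Lemma runs_mul r r1 r2 rs m Q :
  nth 0 rs r1 * nth 0 rs r2 < 2 ^ b ->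
  Q 1 (set_nth 0 rs r (nth 0 rs r1 * nth 0 rs r2)) m ->
  runs b (Op r OMul r1 r2) rs m Q.
Proof. by move=> h; apply: runs_op; apply: modn_small. Qed.

Lemma runs_div r r1 r2 rs m Q :
  nth 0 rs r1 < 2 ^ b ->
  Q 1 (set_nth 0 rs r (nth 0 rs r1 %/ nth 0 rs r2)) m ->
  runs b (Op r ODiv r1 r2) rs m Q.
Proof.
by move=> h; apply: runs_op; apply: modn_small; apply: leq_ltn_trans h;
   apply: leq_div.
Qed.

Lemma runs_mod r r1 r2 rs m Q :
  nth 0 rs r1 < 2 ^ b ->
  Q 1 (set_nth 0 rs r (nth 0 rs r1 %% nth 0 rs r2)) m ->
  runs b (Op r OMod r1 r2) rs m Q.
Proof.
by move=> h; apply: runs_op; apply: modn_small; apply: leq_ltn_trans h;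
   apply: leq_mod.
Qed.

Lemma runs_lt r r1 r2 rs m Q :
  1 < 2 ^ b -> Q 1 (set_nth 0 rs r (nth 0 rs r1 < nth 0 rs r2)) m ->
  runs b (Op r OLt r1 r2) rs m Q.
Proof.
by move=> h; apply: runs_op; apply: modn_small; apply: leq_ltn_trans h;
   apply: leq_b1.
Qed.

Lemma runs_eq r r1 r2 rs m Q :
  1 < 2 ^ b -> Q 1 (set_nth 0 rs r (nth 0 rs r1 == nth 0 rs r2)) m ->
  runs b (Op r OEq r1 r2) rs m Q.
Proof.
by move=> h; apply: runs_op; apply: modn_small; apply: leq_ltn_trans h;
   apply: leq_b1.
Qed.

Lemma runs_read r a rs m Q :
  Q 1 (set_nth 0 rs r (m (nth 0 rs a))) m -> runs b (Read r a) rs m Q.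
Proof.
move=> q st e1 e2; exists 1, (set_reg st r (Defs.mem st (regs st a))).
exists (set_nth 0 rs r (m (nth 0 rs a))), m; split=> //; first by constructor.
by rewrite e1 e2; apply: upd_set_nth.
Qed.

Lemma runs_write r a rs m Q :
  Q 1 rs (upd m (nth 0 rs a) (nth 0 rs r)) -> runs b (Write a r) rs m Q.
Proof.
move=> q st e1 e2; exists 1, (set_mem st (regs st a) (regs st r)), rs.
exists (upd m (nth 0 rs a) (nth 0 rs r)); split=> //; first by constructor.
by move=> i; rewrite /= /upd !e1 e2.
Qed.

Lemma runs_seq p q rs m Q :
  runs b p rs m (fun t rs' m' => runs b q rs' m' (fun t' => Q (t + t'))) ->
  runs b (Seq p q) rs m Q.
Proof.
move=> H st e1 e2.
have [t1 [st1 [rs1 [m1 [x1 f1 f2 H']]]]] := H st e1 e2.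
have [t2 [st2 [rs2 [m2 [x2 g1 g2 q2]]]]] := H' st1 f1 f2.
by exists (t1 + t2), st2, rs2, m2; split=> //; apply: exec_seq x1 x2.
Qed.

Lemma runs_if r p q rs m Q :
  (nth 0 rs r != 0 -> runs b p rs m (fun t => Q t.+1)) ->
  (nth 0 rs r = 0 -> runs b q rs m (fun t => Q t.+1)) ->
  runs b (If r p q) rs m Q.
Proof.
move=> H1 H2 st e1 e2; case: (eqVneq (nth 0 rs r) 0) => [e|ne].
  have [t [st' [rs' [m' [x f1 f2 q']]]]] := H2 e st e1 e2.
  by exists t.+1, st', rs', m'; split=> //; apply: exec_if_false; rewrite ?e1.
have [t [st' [rs' [m' [x f1 f2 q']]]]] := H1 ne st e1 e2.
by exists t.+1, st', rs', m'; split=> //; apply: exec_if_true; rewrite ?e1.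
Qed.

(** A round costs at most [K] steps and one test, and the last test one more. Only an upper bound
    [N] on the rounds is asked, since the length of the search is not known beforehand. *)
Lemma runs_while (I : nat -> seq nat -> (nat -> nat) -> Prop) K N r p rs m :
  (forall k rs m, I k rs m -> nth 0 rs r != 0 ->
     k < N /\ runs b p rs m (fun t rs' m' => t <= K /\ I k.+1 rs' m')) ->
  I 0 rs m ->
  runs b (While r p) rs m (fun t rs' m' => t <= K.+1 * N + 1 /\
    exists k, I k rs' m' /\ nth 0 rs' r = 0).
Proof.
move=> body; have : 0 + N = N by [].
(* Induct on the number [j] of rounds still allowed. *)
suff gen j : forall k rs m, k + j = N -> I k rs m ->
  runs b (While r p) rs m (fun t rs' m' => t <= K.+1 * j + 1 /\
    exists k, I k rs' m' /\ nth 0 rs' r = 0) by apply: gen.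
elim: j => [|j IH] {}k {}rs {}m kj Ik st e1 e2.
  case: (eqVneq (nth 0 rs r) 0) => [e|/(body _ _ _ Ik)[]]; last by lia.
  exists 1, st, rs, m; split=> //; first by apply: exec_while_false; rewrite e1.
  by split; [lia | exists k].
case: (eqVneq (nth 0 rs r) 0) => [e|ne].
  exists 1, st, rs, m; split=> //; first by apply: exec_while_false; rewrite e1.
  by split; [lia | exists k].
have [_ H] := body _ _ _ Ik ne.
have [t1 [st1 [rs1 [m1 [x1 f1 f2 [t1K I1]]]]]] := H st e1 e2.
have [|t2 [st2 [rs2 [m2 [x2 g1 g2 [t2K H2]]]]]] := IH _ _ _ _ I1 st1 f1 f2.
  by lia.
exists (t1 + t2).+1, st2, rs2, m2; split=> //.
  by apply: exec_while_true x1 x2; rewrite e1.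
by split=> //; lia.
Qed.

End Rules.

(** * The program *)

Definition block := foldr Seq Skip.

Local Notation rN := 0 (only parsing).
Local Notation rB := 1 (only parsing).
Local Notation r1 := 2 (only parsing).
Local Notation r3 := 3 (only parsing).
Local Notation r4 := 4 (only parsing).
Local Notation rBase := 5 (only parsing).
Local Notation rH := 6 (only parsing).
Local Notation rT := 7 (only parsing).
Local Notation rC := 8 (only parsing).
Local Notation rD := 9 (only parsing).
Local Notation rV := 10 (only parsing).
Local Notation rVr := 11 (only parsing).
Local Notation rDv := 12 (only parsing).
Local Notation rC' := 13 (only parsing).
Local Notation rD' := 14 (only parsing).
Local Notation rY := 15 (only parsing).
Local Notation rYr := 16 (only parsing).
Local Notation rP := 17 (only parsing).
Local Notation rDy := 18 (only parsing).
Local Notation rA := 19 (only parsing).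
Local Notation rX := 20 (only parsing).
Local Notation rF := 21 (only parsing).

Definition regfile n B h t c d v vr dv c' d' y yr p dy a x f : seq nat :=
  [:: n; B; 1; 3; 4; n * n; h; t; c; d; v; vr; dv; c'; d'; y; yr; p; dy; a; x; f].

(* The table starts at cell n^2: cells 4c + n^2, 4c + n^2 + 1, 4c + n^2 + 2 hold
   tD, tP and tV of state c, and cell 4i + n^2 + 3 the i-th entry of the queue. *)
Definition insert_prog := block
  [:: Op rA OMul rC' r4; Op rA OAdd rA rBase; Read rX rA;
      If rX (Op rF OLt rD' rX)
        (block [:: Op rX OMul rT r4; Op rX OAdd rX rBase; Op rX OAdd rX r3;
                   Write rX rC'; Op rT OAdd rT r1; Const rF 1]);
      If rF (block [:: Write rA rD'; Op rA OAdd rA r1; Write rA rC;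
                       Op rA OAdd rA r1; Write rA rV])
        Skip].

(** [rYr] sheds one digit per round and [rP] holds the place value, so each digit takes constantly
    many steps. Adding a register that holds 0 serves as a copy. *)
Definition succ_prog := block
  [:: Const rC' 0; Const rP 1; Op rYr OAdd rC rC'; Const rY 0; Op rF OLt rY rN;
      While rF (block
        [:: Op rDy OMod rYr rB; Op rYr ODiv rYr rB; Op rX OEq rY rV;
            If rX Skip (If rDy (block
              [:: Op rA OMul rV rN; Op rA OAdd rA rY; Read rA rA;
                  Op rX OAdd rDv rA; Op rX OLt rX rDy;
                  If rX (Op rA OSub rDy rDv) Skip;
                  Op rA OAdd rA r1; Op rA OMul rA rP; Op rC' OAdd rC' rA])
              Skip);
            Op rP OMul rP rB; Op rY OAdd rY r1; Op rF OLt rY rN])].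

Definition expand_prog := block
  [:: Const rV 0; Op rVr OAdd rC rV; Op rF OLt rV rN;
      While rF (block
        [:: Op rDv OMod rVr rB; Op rVr ODiv rVr rB;
            If rDv (block [:: succ_prog; Op rD' OAdd rD rDv; Op rD' OSub rD' r1;
                              insert_prog])
              Skip;
            Op rV OAdd rV r1; Op rF OLt rV rN])].

Definition bfs_prog := block
  [:: Op rF OLt rH rT;
      While rF (block
        [:: Op rA OMul rH r4; Op rA OAdd rA rBase; Op rA OAdd rA r3; Read rC rA;
            Op rA OMul rC r4; Op rA OAdd rA rBase; Read rD rA;
            expand_prog; Op rH OAdd rH r1; Op rF OLt rH rT])].

(** Horner's rule builds the initial state, whose digits are all 1. *)
Definition init_prog := block
  [:: Const r1 1; Const r3 3; Const r4 4; Const rX 2; Op rB OAdd rB rX;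
      Op rBase OMul rN rN; Const rC' 0; Const rY 0; Op rF OLt rY rN;
      While rF (block
        [:: Op rC' OMul rC' rB; Op rC' OAdd rC' r1;
            Op rY OAdd rY r1; Op rF OLt rY rN]);
      Const rD' 1; insert_prog].

(** The walk starts at state 0, where all vertices are coloured. Colours are written to matrix
    cells, so the table survives, and cell [n * n] still holds the span entry of state 0. *)
Definition trace_prog := block
  [:: Const rC 0; Const rY 0; Op rF OLt rY rN;
      While rF (block
        [:: Op rA OMul rC r4; Op rA OAdd rA rBase; Read rD rA;
            Op rA OAdd rA r1; Read rC rA; Op rA OAdd rA r1; Read rV rA;
            Write rV rD; Op rY OAdd rY r1; Op rF OLt rY rN]);
      Read rN rBase].

(** Without vertices, register 0 already holds the optimal span 0. *)
Definition channel_prog :=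
  If rN (block [:: init_prog; bfs_prog; trace_prog]) Skip.

Ltac instr := lazymatch goal with
  | |- runs _ (Const _ _) _ _ _ => apply: runs_const
  | |- runs _ (Op _ OAdd _ _) _ _ _ => apply: runs_add
  | |- runs _ (Op _ OSub _ _) _ _ _ => apply: runs_sub
  | |- runs _ (Op _ OMul _ _) _ _ _ => apply: runs_mul
  | |- runs _ (Op _ ODiv _ _) _ _ _ => apply: runs_div
  | |- runs _ (Op _ OMod _ _) _ _ _ => apply: runs_mod
  | |- runs _ (Op _ OLt _ _) _ _ _ => apply: runs_lt
  | |- runs _ (Op _ OEq _ _) _ _ _ => apply: runs_eq
  | |- runs _ (Read _ _) _ _ _ => apply: runs_read
  | |- runs _ (Write _ _) _ _ _ => apply: runs_write
  | |- runs _ Skip _ _ _ => apply: runs_skip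
  end; cbn [nth set_nth];
  lazymatch goal with |- is_true _ => try lia | _ => idtac end.
Ltac step := apply: runs_seq; instr.

(** * Correctness and running time of the program *)

Section Program.
Variables (n l b U : nat) (W : nat -> nat -> nat).
Local Notation B := l.+2.
Hypothesis W_le : forall x y, W x y <= l.
Hypothesis n0 : 0 < n.
(** [U] bounds the codes and the queue length; [fits] then keeps addresses and intermediate results
    within a word. *)
Hypothesis BU : B ^ n <= U.
Hypothesis NU : 2 ^ n * l.+1 ^ n./2 <= U.
Hypothesis fits : 4 * U + n * n + n + n * l + 2 * B + 8 <= 2 ^ b.

Definition rep_matrix (m : nat -> nat) :=
  forall v y, v < n -> y < n -> m (v * n + y) = W v y.

Definition rep (S : table) (m : nat -> nat) :=
  [/\ rep_matrix m,
      forall c, m (c * 4 + n * n) = tD S c,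
      forall c, m (c * 4 + n * n + 1) = tP S c,
      forall c, m (c * 4 + n * n + 1 + 1) = tV S c
    & forall i, i < size (tQ S) -> m (i * 4 + n * n + 3) = nth 0 (tQ S) i].

Lemma upd_ne (f : nat -> nat) i v j : j != i -> upd f i v j = f j.
Proof. by rewrite /upd => /negPf ->. Qed.

Lemma upd_eq (f : nat -> nat) i v : upd f i v i = v.
Proof. by rewrite /upd eqxx. Qed.

(** Recovers the final counter from the flag with which a loop stops. *)
Lemma flag0 i j : i <= j -> (i < j) = 0 :> nat -> i = j.
Proof. by move=> ij; case: ltnP => // ji _; apply/eqP; rewrite eqn_leq ij. Qed.

Lemma cell_lt v y : v < n -> y < n -> v * n + y < n * n.
Proof.
move=> vn yn; have : v.+1 * n <= n * n by rewrite leq_mul2r vn orbT.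
by rewrite mulSn; lia.
Qed.

(** After the offset [n * n] the four arrays occupy the four residues modulo 4, and the matrix lies
    below, so a write to one leaves the others intact. *)
Lemma rep_push S m c : rep S m ->
  rep (Table (tD S) (tP S) (tV S) (rcons (tQ S) c))
      (upd m (size (tQ S) * 4 + n * n + 3) c).
Proof.
case=> mW mD mP mV mQ; split=> /=.
- by move=> v y vn yn; have lt := cell_lt vn yn; rewrite upd_ne ?mW //; lia.
- by move=> c1; rewrite upd_ne ?mD //; lia.
- by move=> c1; rewrite upd_ne ?mP //; lia.
- by move=> c1; rewrite upd_ne ?mV //; lia.
- move=> i; rewrite size_rcons ltnS nth_rcons leq_eqVlt.
  case: eqP => [-> _|_ /= iQ]; first by rewrite ltnn upd_eq.
  by rewrite iQ upd_ne ?mQ //; lia.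
Qed.

Lemma rep_update S m c' d c v (a := c' * 4 + n * n) : rep S m ->
  rep (Table (upd (tD S) c' d) (upd (tP S) c' c) (upd (tV S) c' v) (tQ S))
      (upd (upd (upd m a d) (a + 1) c) (a + 1 + 1) v).
Proof.
rewrite /a; case=> mW mD mP mV mQ; split=> /=.
- by move=> w y wn yn; have lt := cell_lt wn yn; rewrite !upd_ne ?mW //; lia.
- move=> c1; rewrite 2?upd_ne; try lia.
  case: (eqVneq c1 c') => [->|ne]; first by rewrite !upd_eq.
  by rewrite !upd_ne ?mD //; lia.
- move=> c1; rewrite upd_ne; try lia.
  case: (eqVneq c1 c') => [->|ne]; first by rewrite !upd_eq.
  by rewrite !upd_ne ?mP //; lia.
- move=> c1; case: (eqVneq c1 c') => [->|ne]; first by rewrite !upd_eq.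
  by rewrite !upd_ne ?mV //; lia.
- by move=> i iQ; rewrite !upd_ne ?mQ //; lia.
Qed.

Lemma insert_runs S h c d v vr dv c' d' y yr p dy a x f m :
  rep S m -> c' < U -> size (tQ S) <= U ->
  runs b insert_prog
    (regfile n B h (size (tQ S)) c d v vr dv c' d' y yr p dy a x f) m
    (fun t rs' m' => [/\ t <= 30,
      exists a' x' f', rs' = regfile n B h (size (tQ (insert S c' d' c v)))
        c d v vr dv c' d' y yr p dy a' x' f'
      & rep (insert S c' d' c v) m']).
Proof.
move=> repS c'U sU; have [mW mD mP mV mQ] := repS; rewrite /regfile.
step; step; step; rewrite mD.
apply: runs_seq; apply: runs_if; cbn [nth set_nth] => x0.
  instr.
  apply: runs_seq; apply: runs_if; cbn [nth set_nth] => lt.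
    do 5! step; instr; instr.
    have -> : insert S c' d' c v = Table (upd (tD S) c' d') (upd (tP S) c' c)
      (upd (tV S) c' v) (tQ S).
      by rewrite /insert (negPf x0); case: (d' < _) lt.
    by split=> //; [do 3! eexists | apply: rep_update].
  instr; instr; have -> : insert S c' d' c v = S.
    by rewrite /insert (negPf x0); case: (d' < _) lt.
  by split=> //; do 3! eexists.
do 6! step; instr.
apply: runs_seq; apply: runs_if; cbn [nth set_nth] => // _.
do 5! step; instr; instr; rewrite [size _ + 1]addn1 -(size_rcons _ c').
have -> : insert S c' d' c v = Table (upd (tD S) c' d') (upd (tP S) c' c)
  (upd (tV S) c' v) (rcons (tQ S) c') by rewrite /insert x0.
split=> //; first by do 3! eexists.
exact: (rep_update _ _ _ _ (rep_push c' repS)).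
Qed.

Lemma succ_runs h c d v vr dv c' d' y yr p dy a x f t m :
  rep_matrix m -> c < U -> v < n -> dig l c v != 0 -> dv = dig l c v ->
  runs b succ_prog (regfile n B h t c d v vr dv c' d' y yr p dy a x f) m
    (fun tm rs' m' => [/\ tm <= 30 * n + 10,
      exists y' yr' p' dy' a' x' f', rs' = regfile n B h t c d v vr dv
        (succ n l W c v) d' y' yr' p' dy' a' x' f'
      & m' = m]).
Proof.
move=> mW cU vn dv0 ->; rewrite /regfile.
have pU k : k <= n -> B ^ k <= U.
  by move=> kn; apply: leq_trans BU; rewrite leq_exp2l.
have mkU k : k <= n -> mk l k (bump l W c v) < U.
  move=> kn; apply: leq_trans (pU _ kn).
  by apply: mk_lt => i _; apply: bump_lt.
do 5! step; rewrite addn0.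
(* After [k] rounds the lowest [k] digits of the successor are assembled and those of [c] are
   shifted out. *)
pose I k rs m1 := [/\ k <= n, m1 = m & exists dy a x, rs =
  regfile n B h t c d v vr (dig l c v) (mk l k (bump l W c v)) d' k (c %/ B ^ k)
    (B ^ k) dy a x (k < n)].
apply: runs_seq; apply: runs_conseq (@runs_while b I 28 n _ _ _ _ _ _);
    last first.
- by split=> //; do 3! eexists; rewrite /mk big_ord0 expn0 divn1.
- move=> k rs m1 [kn -> [dy' [a' [x' ->]]]]; cbn [nth] => kf.
  have {kf}kn' : k < n by case: (k < n) kf.
  split=> //; rewrite /regfile.
  have yrU : c %/ B ^ k <= c by apply: leq_div.
  have vB := dig_lt l c v; have yB := dig_lt l c k; have wl := W_le v k.
  have lt := cell_lt vn kn'.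
  step; rewrite -/(dig l c k); step; rewrite -divnMA -expnSr.
  step; apply: runs_seq.
  (* The end of a round is common to all branches; [tm] is the cost of the branch taken. *)
  have next tm a1 x1 : tm <= 16 ->
    runs b (Seq (Op rP OMul rP rB) (Seq (Op rY OAdd rY r1)
             (Seq (Op rF OLt rY rN) Skip)))
      (regfile n B h t c d v vr (dig l c v) (mk l k.+1 (bump l W c v)) d' k
        (c %/ B ^ k.+1) (B ^ k) (dig l c k) a1 x1 (k < n)) m
      (fun t' rs' m' => 1 + (1 + (1 + (tm + t'))) <= 28 /\ I k.+1 rs' m').
    move=> tm16; rewrite /regfile.
    have pk := pU _ kn'; rewrite expnSr in pk.
    step; step; step; instr; split; first lia.
    by split=> //; do 3! eexists; rewrite addn1 expnSr.
  apply: runs_if; cbn [nth set_nth] => yv.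
    instr; have {}yv : k = v by apply/eqP; case: (k == v) yv.
    have e : mk l k.+1 (bump l W c v) = mk l k (bump l W c v).
      by rewrite mk_recr /bump yv eqxx mul0n addn0.
    by rewrite -e; apply: next.
  apply: runs_if; cbn [nth set_nth] => dy0; last first.
    instr; have e : mk l k.+1 (bump l W c v) = mk l k (bump l W c v).
      by rewrite mk_recr /bump dy0 eqxx orbT mul0n addn0.
    by rewrite -e; apply: next.
  have mkE : mk l k.+1 (bump l W c v) = mk l k (bump l W c v) +
      (if dig l c v + W v k < dig l c k then dig l c k - dig l c v + 1
       else W v k + 1) * B ^ k.
    rewrite mk_recr /bump (negPf dy0) orbF; case: (k == v) yv => // _.
    by case: ifP => _; rewrite addn1.
  (* The new partial sum is below [U], so its last summand, the product with the place value, fits a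
     word too. *)
  have mkU' := mkU _ kn'; rewrite mkE in mkU'.
  step; step; step; rewrite mW //; step; step; apply: runs_seq.
  apply: runs_if; cbn [nth set_nth] => lt1.
    have {}lt1 : dig l c v + W v k < dig l c k by case: ltnP lt1.
    rewrite lt1 in mkE mkU'.
    instr.
    step; step; step; instr.
    by rewrite -mkE; apply: next.
  have {}lt1 : (dig l c v + W v k < dig l c k) = false by case: ltnP lt1.
  rewrite lt1 in mkE mkU' *.
  instr; step; step; step; instr.
  by rewrite -mkE; apply: next.
move=> tm rs m1 [tmn [k [[kn -> [dy' [a' [x' ->]]]]]]]; cbn [nth] => kf.
have {k kn kf}-> := flag0 kn kf; instr; split=> //; first by lia.
by do 7! eexists.
Qed.

Lemma expandS k S c d :
  expand n l W k.+1 S c d = relax n l W (expand n l W k S c d) c d k.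
Proof. by []. Qed.

Lemma expand_runs S h c d v vr dv c' d' y yr p dy a x f m :
  rep S m -> c < U -> d <= (n * l).+1 ->
  (forall k, k <= n -> size (tQ (expand n l W k S c d)) <= U) ->
  runs b expand_prog
    (regfile n B h (size (tQ S)) c d v vr dv c' d' y yr p dy a x f) m
    (fun tm rs' m' => [/\ tm <= (30 * n + 60) * n + 10,
      exists v vr dv c' d' y yr p dy a x f, rs' = regfile n B h
        (size (tQ (expand n l W n S c d))) c d v vr dv c' d' y yr p dy a x f
      & rep (expand n l W n S c d) m']).
Proof.
move=> repS cU dn szU; rewrite /regfile.
do 3! step; rewrite addn0.
pose I k rs m1 := [/\ k <= n, rep (expand n l W k S c d) m1 &
  exists dv c' d' y yr p dy a x, rs = regfile n B h
    (size (tQ (expand n l W k S c d))) c d k (c %/ B ^ k) dv c' d' y yr p dy a x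
    (k < n)].
apply: runs_seq; apply: runs_conseq (@runs_while b I (30 * n + 50) n _ _ _ _ _ _);
    last first.
- by split=> //; do 9! eexists; rewrite expn0 divn1.
- move=> k rs m1 [kn repk [dv1 [c1 [d1 [y1 [yr1 [p1 [dy1 [a1 [x1 ->]]]]]]]]]].
  cbn [nth] => kf; have {kf}kn' : k < n by case: (k < n) kf.
  split=> //; rewrite /regfile.
  have yrU : c %/ B ^ k <= c by apply: leq_div.
  have kB := dig_lt l c k.
  step; rewrite -/(dig l c k); step; rewrite -divnMA -expnSr.
  have next tm S1 m2 c2 d2 y2 yr2 p2 dy2 a2 x2 f2 : tm <= 30 * n + 44 ->
    rep S1 m2 -> S1 = expand n l W k.+1 S c d ->
    runs b (Seq (Op rV OAdd rV r1) (Seq (Op rF OLt rV rN) Skip))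
      (regfile n B h (size (tQ S1)) c d k (c %/ B ^ k.+1) (dig l c k) c2 d2 y2
        yr2 p2 dy2 a2 x2 f2) m2
      (fun t' rs' m' => 1 + (1 + (tm + t')) <= 30 * n + 50 /\ I k.+1 rs' m').
    move=> tm16 /[swap] -> rep1; rewrite /regfile.
    step; step; instr; split; first lia.
    by split=> //; do 9! eexists; rewrite addn1.
  apply: runs_seq; apply: runs_if; cbn [nth set_nth] => dk; last first.
    by instr; apply: next => //; [lia | rewrite expandS /relax dk].
  have [mW _ _ _ _] := repk.
  apply: runs_seq.
  eapply runs_conseq; last by apply: succ_runs mW cU kn' dk _.
  move=> t1 rs2 m2 [t1n [y2 [yr2 [p2 [dy2 [a2 [x2 [f2 ->]]]]]]] ->].
  rewrite /regfile; step; step; apply: runs_seq.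
  have sU := succ_lt n W_le dk.
  eapply runs_conseq; last apply: insert_runs repk _ _.
  - move=> t2 rs3 m3 [t2n [a3 [x3 [f3 ->]]] rep3]; instr.
    by apply: next => //; [lia | rewrite expandS /relax (negPf dk)].
  - exact: leq_trans sU BU.
  - exact: szU.
move=> tm rs m1 [tmn [k [[kn repk [dv1 [c1 [d1 [y1 [yr1 [p1 [dy1 [a1
  [x1 ->]]]]]]]]]] ]]].
cbn [nth] => kf; move: repk; have {k kn kf}-> := flag0 kn kf => repk.
instr; split=> //; first by lia.
by do 12! eexists.
Qed.

Local Notation N := (2 ^ n * l.+1 ^ n./2).

(** Bounds the number of rounds of the search and, through [NU], the queue addresses. *)
Lemma search_count S h v : search_inv n l W S h v -> size (tQ S) <= N.
Proof. by move=> inv; apply: count_codes W_le _ (inv_uniq inv) (inv_reach inv). Qed.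

Lemma bfs_runs c d v vr dv c' d' y yr p dy a x f m (S := bfs n l W) :
  rep (S 0) m ->
  runs b bfs_prog
    (regfile n B 0 (size (tQ (S 0))) c d v vr dv c' d' y yr p dy a x f) m
    (fun tm rs' m' => tm <= 121 * (n * n) * N + 10 /\
      exists k h t c d v vr dv c' d' y yr p dy a x f,
      [/\ rs' = regfile n B h t c d v vr dv c' d' y yr p dy a x f,
          search_inv n l W (S k) (size (tQ (S k))) 0 & rep (S k) m']).
Proof.
move=> rep0; rewrite /regfile; have nn : n <= n * n by rewrite leq_pmulr.
step.
pose I k rs m1 := [/\ k <= size (tQ (S k)), search_inv n l W (S k) k 0,
  rep (S k) m1 &
  exists c d v vr dv c' d' y yr p dy a x, rs = regfile n B k (size (tQ (S k)))
    c d v vr dv c' d' y yr p dy a x (k < size (tQ (S k)))].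
apply: runs_seq; apply: runs_conseq
  (@runs_while b I (120 * (n * n)) N _ _ _ _ _ _); last first.
- split=> //; first exact: search_inv0.
  by do 13! eexists.
- move=> k rs m1 [kn inv repk [c1 [d1 [v1 [vr1 [dv1 [c2 [d2 [y1 [yr1 [p1 [dy1
    [a1 [x1 ->]]]]]]]]]]]]]].
  cbn [nth] => kf; have {kf}kQ : k < size (tQ (S k)) by case: ltnP kf.
  have sN := search_count inv; split; first exact: leq_trans sN.
  have [mW mD mP mV mQ] := repk; rewrite /regfile.
  step; step; step; step; rewrite (mQ _ kQ); set c3 := nth 0 _ k.
  have [cB dn] := search_bound W_le inv (mem_nth 0 kQ); rewrite -/c3 in cB dn.
  step; step; step; rewrite mD; apply: runs_seq.
  eapply runs_conseq; last apply: expand_runs repk _ dn _.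
  + move=> t1 rs2 m2 [t1n [v4 [vr4 [dv4 [c4 [d4 [y4 [yr4 [p4 [dy4 [a4 [x4
      [f4 ->]]]]]]]]]]]] rep4].
    have [inv' kQ'] := search_inv_bfs W_le inv kQ.
    have sN' := search_count inv'.
    rewrite /regfile; step; step; instr; split; first lia.
    split=> //.
    by do 13! eexists; rewrite addn1.
  + exact: leq_trans cB BU.
  + move=> j jn; have [inv' _ _ _] := search_inv_expand W_le inv kQ jn.
    exact: leq_trans (search_count inv') NU.
move=> tm rs m1 [tmn [k [[kn inv repk [c1 [d1 [v1 [vr1 [dv1 [c2 [d2 [y1 [yr1
  [p1 [dy1 [a1 [x1 ->]]]]]]]]]]]]]] ]]].
cbn [nth] => kf; have ek := flag0 kn kf.
instr; split; first by nia.
exists k; do 16! eexists; split=> //; by rewrite -ek.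
Qed.

Lemma init_runs m (S := bfs n l W) :
  rep_matrix m -> (forall a, n * n <= a -> m a = 0) ->
  runs b init_prog (n :: l :: nseq 20 0) m
    (fun tm rs' m' => tm <= 6 * n + 60 /\
      exists c d v vr dv c' d' y yr p dy a x f,
      rs' = regfile n B 0 (size (tQ (S 0))) c d v vr dv c' d' y yr p dy a x f /\
      rep (S 0) m').
Proof.
move=> mW m0.
(* Zeroed memory represents the empty table because 0 marks unvisited states. *)
have rep0 : rep table0 m by split=> // *; apply: m0; lia.
rewrite [nseq _ _]/=; have nn : n <= n * n by rewrite leq_pmulr.
do 9! step; rewrite addn2.
have oneB k : mk l k (fun=> 1) < B ^ k by apply: mk_lt.
have oneS k : mk l k.+1 (fun=> 1) = mk l k (fun=> 1) * B + 1.
  rewrite /mk big_ord_recl expn0 muln1 addnC big_distrl /=; congr (_ + _).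
  by apply: eq_bigr => i _; rewrite /= !mul1n expnSr.
pose I k rs m1 := [/\ k <= n, m1 = m & exists x, rs =
  regfile n B 0 0 0 0 0 0 0 (mk l k (fun=> 1)) 0 k 0 0 0 0 x (k < n)].
apply: runs_seq; apply: runs_conseq (@runs_while b I 5 n _ _ _ _ _ _); last first.
- by split=> //; eexists; rewrite /mk big_ord0.
- move=> k rs m1 [kn -> [x ->]]; cbn [nth] => kf.
  have {kf}kn' : k < n by case: (k < n) kf.
  split=> //; rewrite /regfile.
  have kU : mk l k.+1 (fun=> 1) < U.
    by apply: leq_trans (oneB _) (leq_trans _ BU); rewrite leq_exp2l.
  rewrite oneS in kU.
  do 4! step; instr; split=> //; split=> //; eexists.
  by rewrite oneS !addn1.
move=> tm rs m1 [tmn [k [[kn -> [x ->]]]]]; cbn [nth] => kf.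
have {k kn kf}-> := flag0 kn kf; rewrite /regfile; step; apply: runs_seq.
eapply runs_conseq; last apply: insert_runs rep0 _ _.
- move=> t1 rs1 m2 [t1n [a1 [x1 [f1 ->]]] rep1]; instr; split; first lia.
  by do 14! eexists; split.
- exact: leq_trans (oneB n) BU.
- by [].
Qed.

(** A colour is the span right after its vertex is coloured, so the span entries met on the way back
    are the colours to output. *)
Lemma colour_nth vs k : ordering n vs -> k < size vs ->
  colour W vs (nth 0 vs k) = span n l W (drop k vs).
Proof.
elim: vs k => [//|v vs IH] [|k] ov ks.
  by rewrite drop0 (span_cons W_le ov) /= eqxx.
move: ov; rewrite ordering_cons => /and3P[vvs vn ovs].
rewrite /= -IH //; case: eqP => // e.
by rewrite -e mem_nth in vvs.
Qed.

Lemma traced_drop S vs k : traced n l W S vs -> traced n l W S (drop k vs).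
Proof.
by elim: k vs => [|k IH] [|v vs] // [_ _ _ /IH].
Qed.

Lemma ordering_drop vs k : ordering n vs -> ordering n (drop k vs).
Proof.
case/andP=> u /allP vn; rewrite /ordering drop_uniq //.
by apply/allP => i /mem_drop/vn.
Qed.

Lemma trace_runs S h t c d v vr dv c' d' y yr p dy a x f m vs :
  rep S m -> ordering n vs -> size vs = n -> code n l W vs = 0 ->
  traced n l W S vs ->
  runs b trace_prog (regfile n B h t c d v vr dv c' d' y yr p dy a x f) m
    (fun tm rs' m' => [/\ tm <= 12 * n + 10, nth 0 rs' 0 = tD S 0
      & forall u, u \in vs -> m' u = colour W vs u]).
Proof.
move=> [_ mD mP mV _] ovs svs cvs tr; rewrite /regfile.
have nn : n <= n * n by rewrite leq_pmulr.
do 3! step.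
(* The [k] vertices coloured last are done, and [rC] holds the state before them. *)
pose I k rs m1 := [/\ k <= n, forall a, n * n <= a -> m1 a = m a,
  forall u, u \in take k vs -> m1 u = colour W vs u &
  exists h t d v vr dv c' d' yr p dy a x, rs =
    regfile n B h t (code n l W (drop k vs)) d v vr dv c' d' k yr p dy a x
      (k < n)].
apply: runs_seq; apply: runs_conseq (@runs_while b I 11 n _ _ _ _ _ _); last first.
- split=> //; first by move=> u; rewrite take0.
  by do 13! eexists; rewrite drop0 cvs.
- move=> k rs m1 [kn mh mc [h1 [t1 [d1 [v1 [vr1 [dv1 [c1 [d2 [yr1 [p1 [dy1 [a1
    [x1 ->]]]]]]]]]]]]]]; cbn [nth] => kf.
  have {kf}kn' : k < n by case: (k < n) kf.
  have ks : k < size vs by rewrite svs.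
  split=> //; rewrite /regfile.
  have ok := ordering_drop k ovs.
  have cU : code n l W (drop k vs) < U := leq_trans (code_lt W_le ok) BU.
  have := traced_drop k tr; rewrite {1}(drop_nth 0 ks); case.
  rewrite -(drop_nth 0 ks) => eP eV eD _.
  have vkn : nth 0 vs k < n by case/andP: ovs => _ /allP; apply; apply: mem_nth.
  do 3! step; rewrite mh ?mD ?eD; last by lia.
  do 2! step; rewrite mh ?mP ?eP; last by lia.
  do 2! step; rewrite mh ?mV ?eV; last by lia.
  do 3! step; instr; split=> //; split=> //.
  + by move=> a2 a2n; rewrite upd_ne ?mh //; lia.
  + move=> u; rewrite (take_nth 0 ks) mem_rcons inE.
    case: eqP => [-> _|/eqP ne /= uk]; first by rewrite upd_eq colour_nth.
    by rewrite upd_ne ?mc.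
  + by do 13! eexists; rewrite !addn1.
move=> tm rs m1 [tmn [k [[kn mh mc [h1 [t1 [d1 [v1 [vr1 [dv1 [c1 [d2 [yr1 [p1 [dy1
  [a1 [x1 ->]]]]]]]]]]]]]]]]]; cbn [nth] => kf.
have ek := flag0 kn kf; step; instr; split; first lia.
  by rewrite mh // -(mD 0).
by move=> u; rewrite -{1}[vs]take_size svs -ek => /mc.
Qed.

Lemma channel_runs m : rep_matrix m -> (forall a, n * n <= a -> m a = 0) ->
  runs b channel_prog (n :: l :: nseq 20 0) m (fun t rs' m' =>
    t <= 300 * (n * n) * N /\ exists vs,
    [/\ ordering n vs /\ size vs = n, nth 0 rs' 0 = span n l W vs,
      forall u, u \in vs -> m' u = colour W vs u
      & forall vs', ordering n vs' -> size vs' = n ->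
          span n l W vs <= span n l W vs']).
Proof.
move=> mW m0; apply: runs_if => /= [_|n00]; last by lia.
apply: runs_seq; eapply runs_conseq; last exact: init_runs.
move=> t1 rs1 m1 [t1n [c [d [v [vr [dv [c' [d' [y [yr [p [dy [a [x [f
  [-> rep0]]]]]]]]]]]]]]]].
apply: runs_seq; eapply runs_conseq; last exact: bfs_runs.
move=> t2 rs2 m2 [t2n [k [h1 [t3 [c1 [d1 [v1 [vr1 [dv1 [c1' [d1' [y1 [yr1 [p1
  [dy1 [a1 [x1 [f1 [-> inv repk]]]]]]]]]]]]]]]]]]].
have [vs [[ovs svs tr cvs eD] opt]] := final_optimal W_le inv.
apply: runs_seq; eapply runs_conseq; last by apply: trace_runs repk ovs svs cvs tr.
move=> t4 rs3 m3 [t4n e0 mc]; instr; split; last first.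
  by exists vs; split=> //; rewrite e0.
(* Since [0 < n], linear and constant terms are absorbed by [n * n * N]. *)
have nn : n <= n * n by rewrite leq_pmulr.
have N0 : 0 < N by rewrite muln_gt0 !expn_gt0.
have : n * n <= n * n * N by rewrite leq_pmulr.
lia.
Qed.

End Program.

(** * Word length, the real-valued time bound and the theorem *)

Import GRing.Theory Num.Theory.

Lemma nth_allpairs (S T : Type) (f : S -> T -> nat) s t x0 y0 i j :
  i < size s -> j < size t ->
  nth 0 [seq f x y | x <- s, y <- t] (i * size t + j) =
  f (nth x0 s i) (nth y0 t j).
Proof.
move=> + jt; elim: s i => [//|x s IH] [|i] /= is_; rewrite nth_cat size_map.
  by rewrite jt (nth_map y0).
rewrite mulSn -addnA ltnNge leq_addr /= addKn; exact: IH.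
Qed.

(** With [Y = (2 * l.+1) ^ n.+1], each of the six summands is at most [Y * Y], while the word holds
    [Y ^ 4 >= 16 * (Y * Y)]. *)
Lemma word_fits n l b (U := (2 * l.+1) ^ n) : 0 < n ->
  (2 * l.+1) ^ (4 * n.+1) <= 2 ^ b ->
  [/\ l.+2 ^ n <= U, 2 ^ n * l.+1 ^ n./2 <= U
    & 4 * U + n * n + n + n * l + 2 * l.+2 + 8 <= 2 ^ b].
Proof.
move=> n0; rewrite {}/U; set A := 2 * l.+1 => Ab.
have A2 : 2 <= A by rewrite /A; lia.
have nA1 : n.+1 <= A ^ n.
  by apply: leq_trans (ltn_expl n (isT : 1 < 2)) _; rewrite leq_exp2r.
have nA := ltnW nA1.
split.
- by rewrite leq_exp2r // /A; lia.
- by rewrite expnMn leq_mul2l leq_pexp2l ?orbT //; lia.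
apply: leq_trans Ab.
have AX := expnS A n; set X := A ^ n in nA nA1 AX |- *.
have -> : A ^ (4 * n.+1) = (A * X) ^ 4 by rewrite -AX -expnM mulnC.
have lA : l.+2 <= A by rewrite /A; lia.
have X2 : 2 <= X by lia.
clearbody X A; clear AX.
have h1 : n * n <= X * X by apply: leq_mul.
have h2 : n * l <= X * A by apply: leq_mul => //; lia.
set Y := A * X; have Y4 : 4 <= Y by apply: (@leq_mul 2 2).
have XY : X * 2 <= Y by rewrite mulnC leq_mul2r A2 orbT.
have AY : A * 2 <= Y by rewrite leq_mul2l X2 orbT.
have h3 : X * X <= Y * Y by apply: leq_mul; lia.
have h4 : 4 * 4 * (Y * Y) <= Y ^ 4.
  have -> : Y ^ 4 = Y * Y * (Y * Y) by rewrite !expnS expn0 muln1 !mulnA.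
  by rewrite leq_mul // leq_mul.
have h5 : 4 * Y <= Y * Y by rewrite leq_mul2r Y4 orbT.
rewrite (mulnC X A) -/Y in h2; clearbody Y; lia.
Qed.

Lemma steps_bound (R : realType) (n l t : nat) :
  t <= 300 * (n * n) * (2 ^ n * l.+1 ^ n./2) ->
  (t%:R <= 300%:R * (2 ^+ n * (l.+1)%:R `^ (n%:R / 2) * n%:R ^+ 2) :> R)%R.
Proof.
move=> tn.
have tR : (t%:R <= (300 * (n * n) * (2 ^ n * l.+1 ^ n./2))%N%:R :> R)%R.
  by rewrite ler_nat.
apply: Order.POrderTheory.le_trans tR _.
rewrite !natrM !natrX -mulrA ler_wpM2l ?ler0n // mulrC.
rewrite expr2 ler_wpM2r ?mulr_ge0 ?ler0n //.
rewrite ler_wpM2l ?exprn_ge0 ?ler0n //.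
(* The exponent [n./2] is at most the real [n / 2], and the base is at least 1. *)
rewrite -powR_mulrn ?ler0n //; apply: ler_powR; first by rewrite ler1n.
by rewrite ler_pdivlMr // -natrM ler_nat muln2; have := odd_double_half n; lia.
Qed.

(* The word length b may be any value with 2^b >= (2 (l+1))^(K (n+1)), so words
   of O((n+1) log (2 (l+1))) bits suffice, which is the logarithm of the running
   time up to a constant factor.
   For n = 0 the time bound would read O(0), so it is asked only for n > 0. *)
Theorem theorem1 :
  exists (p : prog) (K : nat), forall R : realType, exists C : R,
    forall (V : finType) (l : nat) (w : V -> V -> nat) (b : nat),
      weight_function w -> bounded w l ->
      ((2 * l.+1) ^ (K * #|V|.+1) <= 2 ^ b)%N ->
      exists (t : nat) (st : state),
        [/\ exec b p (input w l) t st,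
            optimal_assignment w (output_span st) (@output_assignment V st)
          & (0 < #|V|)%N ->
            (t%:R <= C * (2 ^+ #|V| * (l.+1)%:R `^ (#|V|%:R / 2)
                            * #|V|%:R ^+ 2))%R].
Proof.
(* The 4 is the exponent in [word_fits], the 300 the constant of [channel_runs]. *)
exists channel_prog, 4 => R; exists (300%:R)%R => V l w b wsym wl bits.
have [V0|n0] := posnP #|V|.
  have noV (x : V) : False by have := card0_eq V0 x; rewrite inE.
  exists 2, (input w l); split; last by rewrite V0.
    by apply: exec_if_false; [rewrite /= V0 | constructor].
  rewrite /output_span /= V0.
  by split=> //; split=> x; case: (noV x).
(* Indexing the flat input makes [rep_matrix] hold by definition, and the default 0 outside the list
   keeps [W] bounded by [l] everywhere. *)
pose W v y := nth 0 [seq w x y | x <- enum V, y <- enum V] (v * #|V| + y).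
pose x0 : V := enum_val (Ordinal n0).
have WE v y : v < #|V| -> y < #|V| ->
    W v y = w (nth x0 (enum V) v) (nth x0 (enum V) y).
  have := @nth_allpairs _ _ w (enum V) (enum V) x0 x0 v y.
  by rewrite -!cardE => + vn yn; apply.
have W_le x y : W x y <= l.
  rewrite /W; set s := [seq _ | _ <- _, _ <- _].
  have [ks|ks] := ltnP (x * #|V| + y) (size s); last by rewrite nth_default.
  by have /allpairsP[[u v] [_ _ ->]] := mem_nth 0 ks; apply: wl.
have Wsym x y : x < #|V| -> y < #|V| -> W x y = W y x.
  by move=> xn yn; rewrite !WE.
have [BU NU fits] := word_fits n0 bits.
have mW : rep_matrix #|V| W (Defs.mem (input w l)) by [].
have m0 a : #|V| * #|V| <= a -> Defs.mem (input w l) a = 0.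
  by move=> an; rewrite /= nth_default // size_allpairs -cardE.
have regs0 : regs (input w l) =1 nth 0 (#|V| :: l :: nseq 20 0).
  by case=> [|[|i]] //=; rewrite -[LHS]/0 (nth_nseq 0 20 0) if_same.
have [t [st [rs' [m' [run er em [tn [vs [[ovs svs] e0 mc opt]]]]]]]] :=
  channel_runs W_le n0 BU NU fits mW m0 regs0 (fun=> erefl).
have rank_lt (x : V) : enum_rank x < #|V| by apply: ltn_ord.
have vsP x : x < #|V| -> x \in vs by apply: ordering_full.
have colE (x : V) : output_assignment st x = colour W vs (enum_rank x).
  by rewrite /output_assignment em mc ?vsP.
have rankE (x : V) : nth x0 (enum V) (enum_rank x) = x.
  exact: nth_enum_rank.
exists t, st; split=> //; last by move=> _; apply: steps_bound.
rewrite /output_span er e0; split.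
  split=> [x|x y xy]; first by rewrite colE colour_bounds ?vsP.
  rewrite !colE; have := colour_proper Wsym ovs (vsP _ (rank_lt x))
    (vsP _ (rank_lt y)).
  rewrite WE // !rankE; apply; apply: contraNneq xy => e.
  by rewrite -(rankE x) e rankE.
move=> s' c' [c's c'w].
(* A competing assignment, transported to indices, yields an ordering whose span is no larger. *)
have [|ws [ows sws]] := @span_min #|V| l W W_le
    (fun i => c' (nth x0 (enum V) i)) s' n0 (fun x _ => c's _).
  move=> x y xn yn xy; rewrite WE //; apply: c'w.
  by rewrite nth_uniq ?enum_uniq -?cardE.
exact: leq_trans (opt _ ows sws).
Qed.
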